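(* The representation $\phi:\Pi A_2\to \mathrm{GL}(2,\mathbb Z)$ given by $$\phi(\mu_{12})=\begin{pmatrix}1&2\\0&1\end{pmatrix},\ \phi(\mu_{21})=\begin{pmatrix}1&0\\2&1\end{pmatrix},\ \phi(\sigma)=\begin{pmatrix}-1&0\\0&1\end{pmatrix},\ \phi(\delta)=\begin{pmatrix}1&0\\0&-1\end{pmatrix},\ \phi(\rho)=\begin{pmatrix}0&1\\1&0\end{pmatrix}$$ is faithful.
   Context: $F_2=\langle x,y\rangle$ is the free group of rank 2. A palindrome is a reduced word in $x^{\pm1},y^{\pm1}$ that equals its reverse word. $\Pi A_2\le\mathrm{Aut}(F_2)$ is the group of all automorphisms mapping each of $x,y$ to a palindrome. Automorphisms act on the right, so products are composed from left to right. The group $\Pi A_2$ is generated by $\mu_{12}: x\mapsto yxy,\ y\mapsto y$; $\mu_{21}: x\mapsto x,\ y\mapsto xyx$; $\sigma: x\mapsto x^{-1},\ y\mapsto y$; $\delta: x\mapsto x,\ y\mapsto y^{-1}$; $\rho: x\mapsto y,\ y\mapsto x$. The representation $\phi$ is the restriction to $\Pi A_2$ of the natural homomorphism $\mathrm{Aut}(F_2)\to \mathrm{GL}(2,\mathbb Z)$ given by the action on the abelianization (the rows of the matrix record the exponent sums of the images of $x$ and $y$). *)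

(* Defs.v *)
From HB Require Import structures.
From mathcomp Require Import all_boot all_algebra.
From mathcomp Require Import boolp.

Set Implicit Arguments.
Unset Strict Implicit.
Unset Printing Implicit Defensive.

Import GRing.Theory.
Local Open Scope group_scope.

Lemma morph_oneg (G H : groupType) (f : {multiplicative G -> H}) : f 1 = 1.
Proof. by apply: (mulgI (f 1)); rewrite -(@gmulfM _ _ f) !mulg1. Qed.

Lemma morph_invg (G H : groupType) (f : {multiplicative G -> H}) :
  {morph f : g / g^-1}.
Proof.
by move=> g; apply: (mulgI (f g)); rewrite -(@gmulfM _ _ f) !mulgV morph_oneg.
Qed.

Section FreeGroup.
Variable T : choiceType.
Implicit Types (a b : T * bool) (u v w : seq (T * bool)).

(* The letter (t, false) stands for t and (t, true) for t^-1. *)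
Definition inv_letter a : T * bool := (a.1, ~~ a.2).

Definition reduced w : bool := sorted (fun a b => b != inv_letter a) w.

Record free_group := FreeGroup { word : seq (T * bool); _ : reduced word }.

HB.instance Definition _ := [isSub for word].
HB.instance Definition _ := [Choice of free_group by <:].

Definition cons_reduce a w : seq (T * bool) :=
  if w is b :: w' then if b == inv_letter a then w' else a :: w else [:: a].

Lemma inv_letterK : involutive inv_letter.
Proof. by case=> t s; rewrite /inv_letter /= negbK. Qed.

Lemma reduced_cons a w : reduced (a :: w) -> reduced w.
Proof. by case: w => //= b w /andP[]. Qed.

Lemma cons_reduce_reduced a w : reduced w -> reduced (cons_reduce a w).
Proof.
case: w => //= b w wP; case: ifPn => [_|ba]; first exact: (@reduced_cons b).
by rewrite /= ba.
Qed.

Lemma cons_reduce_id a w : reduced (a :: w) -> cons_reduce a w = a :: w.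
Proof. by case: w => //= b w /andP[/negPf->]. Qed.

Lemma cons_reduceK a w :
  reduced w -> cons_reduce (inv_letter a) (cons_reduce a w) = w.
Proof.
case: w => [_|b w wP] /=; first by rewrite inv_letterK eqxx.
case: eqP => [ba|_]; last by rewrite /= inv_letterK eqxx.
by rewrite ba in wP *; rewrite cons_reduce_id.
Qed.

Definition cat_reduce u w : seq (T * bool) := foldr cons_reduce w u.

Lemma cat_reduce_reduced u w : reduced w -> reduced (cat_reduce u w).
Proof. by move=> wP; elim: u => //= a u; apply: cons_reduce_reduced. Qed.

Lemma cat_reduce_nil u : reduced u -> cat_reduce u [::] = u.
Proof.
elim: u => //= a u IHu auP; rewrite IHu ?(reduced_cons auP) //.
exact: cons_reduce_id.
Qed.

Lemma cat_reduce_cons a u w : reduced u -> reduced w ->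
  cat_reduce (cons_reduce a u) w = cons_reduce a (cat_reduce u w).
Proof.
case: u => //= b u buP wP; case: eqP => //= ->.
have := @cons_reduceK (inv_letter a) (cat_reduce u w).
by rewrite inv_letterK => -> //; apply: cat_reduce_reduced.
Qed.

Lemma cat_reduceA u v w : reduced v -> reduced w ->
  cat_reduce u (cat_reduce v w) = cat_reduce (cat_reduce u v) w.
Proof.
move=> vP wP; elim: u => //= a u IHu.
by rewrite cat_reduce_cons ?IHu //; apply: cat_reduce_reduced.
Qed.

Definition inv_word w : seq (T * bool) := rev (map inv_letter w).

Lemma inv_wordK : involutive inv_word.
Proof.
move=> w; rewrite /inv_word map_rev revK -map_comp map_id_in // => a _ /=.
exact: inv_letterK.
Qed.

Lemma map_inv_reduced w : reduced w -> reduced (map inv_letter w).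
Proof.
elim: w => // a [|b w] //= IHw /andP[ba wP]; rewrite IHw // andbT.
by rewrite (inj_eq (inv_inj inv_letterK)).
Qed.

Lemma inv_word_reduced w : reduced w -> reduced (inv_word w).
Proof.
move/map_inv_reduced; rewrite /reduced /inv_word rev_sorted.
by apply: sub_sorted => a b; apply: contra => /eqP->; rewrite inv_letterK.
Qed.

Lemma cat_reduceV u w :
  reduced w -> cat_reduce (inv_word u) (cat_reduce u w) = w.
Proof.
move=> wP; rewrite /cat_reduce -foldr_cat.
elim: u w wP => //= a u IHu w wP.
rewrite /inv_word /= rev_cons cat_rcons foldr_cat /=.
rewrite cons_reduceK; last exact: cat_reduce_reduced.
by rewrite -foldr_cat IHu.
Qed.

Lemma wordP (g : free_group) : reduced (word g). Proof. by case: g. Qed.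

Definition free_one : free_group := @FreeGroup [::] isT.
Definition free_mul (g h : free_group) : free_group :=
  FreeGroup (cat_reduce_reduced (word g) (wordP h)).
Definition free_inv (g : free_group) : free_group :=
  FreeGroup (inv_word_reduced (wordP g)).

Lemma free_mulA : associative free_mul.
Proof.
by move=> f g h; apply: val_inj => /=; apply: cat_reduceA; apply: wordP.
Qed.

Lemma free_mul1g : left_id free_one free_mul.
Proof. by move=> g; apply: val_inj. Qed.

Lemma free_mulg1 : right_id free_one free_mul.
Proof. by move=> g; apply: val_inj => /=; apply/cat_reduce_nil/wordP. Qed.

Lemma free_mulVg : left_inverse free_one free_inv free_mul.
Proof.
move=> g; apply: val_inj => /=.
by rewrite -[X in cat_reduce _ X](cat_reduce_nil (wordP g)) cat_reduceV.
Qed.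

Lemma free_mulgV : right_inverse free_one free_inv free_mul.
Proof.
move=> g; have gK : free_inv (free_inv g) = g.
  by apply: val_inj; apply: inv_wordK.
by rewrite -[X in free_mul X]gK free_mulVg.
Qed.

HB.instance Definition _ := isGroup.Build free_group
  free_mulA free_mul1g free_mulg1 free_mulVg free_mulgV.

Definition free_gen (t : T) : free_group := @FreeGroup [:: (t, false)] isT.

Section Lift.
Variables (G : groupType) (f : T -> G).

Definition lift_letter a : G := if a.2 then (f a.1)^-1 else f a.1.

Definition free_lift (g : free_group) : G :=
  foldr (fun a z => lift_letter a * z) 1 (word g).

Lemma lift_letterV a : lift_letter (inv_letter a) = (lift_letter a)^-1.
Proof. by case: a => t []; rewrite /lift_letter //= invgK. Qed.

Lemma free_liftM : {morph free_lift : g h / g * h}.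
Proof.
case=> u uP [v vP]; rewrite /free_lift /= {uP}.
elim: u => [|a u IHu] /=; first by rewrite mul1g.
rewrite -mulgA -IHu; case: (cat_reduce u v) => //= b w.
by case: eqP => //= ->; rewrite lift_letterV mulVKg.
Qed.

HB.instance Definition _ :=
  isMultiplicative.Build free_group G free_lift free_liftM.

Lemma free_lift_gen t : free_lift (free_gen t) = f t.
Proof. exact: mulg1. Qed.

Lemma free_liftE (h : {multiplicative free_group -> G}) :
  (forall t, h (free_gen t) = f t) -> h =1 free_lift.
Proof.
move=> hf.
have ha a (aP : reduced [:: a]) : h (FreeGroup aP) = lift_letter a.
  case: a aP => t [] aP; rewrite /lift_letter /= -hf -?morph_invg;
    by congr (h _); apply: val_inj.
case=> w wP; rewrite /free_lift /=; elim: w wP => [|a w IHw] awP /=.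
  by rewrite -[RHS](morph_oneg h); congr (h _); apply: val_inj.
rewrite -(IHw (reduced_cons awP)) -(ha a isT) -(@gmulfM _ _ h).
by congr (h _); apply: val_inj; rewrite /= cons_reduce_id.
Qed.

End Lift.

Lemma free_ext (G : groupType) (h k : {multiplicative free_group -> G}) :
  (forall t, h (free_gen t) = k (free_gen t)) -> h =1 k.
Proof.
move=> hk g; rewrite (@free_liftE G (fun t => k (free_gen t)) h hk).
by rewrite (@free_liftE G (fun t => k (free_gen t)) k).
Qed.

Definition palindrome (g : free_group) : bool := rev (word g) == word g.

(* The reverse of g is the inverse of free_bar g, so that the palindromes are
   the elements inverted by free_bar. *)
Definition free_bar : free_group -> free_group :=
  free_lift (fun t => (free_gen t)^-1).
HB.instance Definition _ := Multiplicative.on free_bar.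

Lemma word_bar g : word (free_bar g) = map inv_letter (word g).
Proof.
case: g => w wP; rewrite /free_bar /free_lift /=; elim: w wP => //= a w IHw awP.
have E : word (lift_letter (fun t => (free_gen t)^-1) a) = [:: inv_letter a].
  by case: a {awP} => t [].
rewrite E /= IHw ?(reduced_cons awP) //.
by apply: cons_reduce_id; apply: (@map_inv_reduced (a :: w)).
Qed.

Lemma palindromeE g : palindrome g = (free_bar g == g^-1).
Proof.
rewrite -val_eqE /= word_bar /inv_word -map_rev eq_sym /palindrome.
by rewrite (inj_eq (inj_map (inv_inj inv_letterK))).
Qed.

(* The exponent sum of t in g. *)
Definition expsum (t : T) (g : free_group) : int :=
  (\sum_(a <- word g | a.1 == t) (-1) ^+ a.2)%R.

Lemma expsumM t g h : expsum t (g * h) = (expsum t g + expsum t h)%R.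
Proof.
case: g h => [u uP] [v vP]; rewrite /expsum /= {uP}.
elim: u => [|a u IHu] /=; first by rewrite big_nil add0r.
rewrite big_cons; set c := (if _ then _ else _); set w := cat_reduce u v in IHu *.
have -> : c = ((if a.1 == t then (-1) ^+ a.2 else 0)
                + \sum_(b <- u | b.1 == t) (-1) ^+ b.2)%R.
  by rewrite /c; case: ifP; rewrite ?add0r.
rewrite -addrA -IHu {}/c; case: w {IHu} => [|b w] /=.
  by rewrite big_cons big_nil; case: ifP; rewrite ?addr0.
case: eqP => [->|_]; rewrite !big_cons /=.
  by case: ifP; rewrite ?add0r // addrA; case: (a.2); rewrite ?addNr ?subrr add0r.
by case: ifP; rewrite ?add0r.
Qed.

Lemma expsum1 t : expsum t 1 = 0%R.
Proof. by rewrite /expsum big_nil. Qed.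

Lemma expsumV t g : expsum t g^-1 = (- expsum t g)%R.
Proof. by apply/eqP; rewrite -addr_eq0 -expsumM mulVg expsum1. Qed.

Lemma expsum_gen t s : expsum t (free_gen s) = (s == t)%:R%R.
Proof. by rewrite /expsum big_cons big_nil /=; case: ifP. Qed.

End FreeGroup.

Section AutomorphismGroup.
Variable G : groupType.

Record autg := Autg {
  autg_fun :> G -> G;
  autgM : {morph autg_fun : x y / x * y};
  autg_bij : bijective autg_fun }.

HB.instance Definition _ := gen_eqMixin autg.
HB.instance Definition _ := gen_choiceMixin autg.
HB.instance Definition _ (f : autg) :=
  isMultiplicative.Build G G f (autgM f).

Lemma autg_ext (f g : autg) : f =1 g -> f = g.
Proof.
case: f g => [f fM fB] [g gM gB] /= /funext fg; rewrite {}fg in fM fB *.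
by congr Autg; apply: Prop_irrelevance.
Qed.

Lemma autg_invP (f : autg) : exists g : autg, cancel f g /\ cancel g f.
Proof.
case: (autg_bij f) => g fK gK.
by exists (Autg (can2_gmulfM fK gK) (Bijective gK fK)).
Qed.

Lemma idfunM : {morph @idfun G : x y / x * y}. Proof. by []. Qed.
Definition autg_one : autg := Autg idfunM (Bijective (fun=> erefl) (fun=> erefl)).

(* Automorphisms act on the right: f * g is f followed by g. *)
Definition autg_mul (f g : autg) : autg :=
  @Autg (g \o f) (@gmulfM _ _ (g \o f)) (bij_comp (autg_bij g) (autg_bij f)).

Definition autg_inv (f : autg) : autg := projT1 (cid (autg_invP f)).

Lemma autg_mulA : associative autg_mul.
Proof. by move=> f g h; apply: autg_ext. Qed.

Lemma autg_mul1g : left_id autg_one autg_mul.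
Proof. by move=> f; apply: autg_ext. Qed.

Lemma autg_mulg1 : right_id autg_one autg_mul.
Proof. by move=> f; apply: autg_ext. Qed.

Lemma autg_mulVg : left_inverse autg_one autg_inv autg_mul.
Proof.
move=> f; apply: autg_ext => z /=; rewrite /autg_inv.
by case: cid => g [/= _ ->].
Qed.

Lemma autg_mulgV : right_inverse autg_one autg_inv autg_mul.
Proof.
move=> f; apply: autg_ext => z /=; rewrite /autg_inv.
by case: cid => g [/= ->].
Qed.

HB.instance Definition _ := isGroup.Build autg
  autg_mulA autg_mul1g autg_mulg1 autg_mulVg autg_mulgV.

End AutomorphismGroup.

Section UnitGroup.
Variable R : unitRingType.

Record unitg := Unitg { unitg_val :> R; _ : unitg_val \is a GRing.unit }.

HB.instance Definition _ := [isSub for unitg_val].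
HB.instance Definition _ := [Choice of unitg by <:].

Lemma unitgP (u : unitg) : unitg_val u \is a GRing.unit. Proof. by case: u. Qed.

Lemma unitg_mul_subproof (u v : unitg) : (unitg_val u * unitg_val v)%R \is a GRing.unit.
Proof. by rewrite unitrMr unitgP. Qed.

Lemma unitg_inv_subproof (u : unitg) : (unitg_val u)^-1%R \is a GRing.unit.
Proof. by rewrite unitrV unitgP. Qed.

Definition unitg_one : unitg := Unitg (unitr1 R).
Definition unitg_mul (u v : unitg) : unitg := Unitg (unitg_mul_subproof u v).
Definition unitg_inv (u : unitg) : unitg := Unitg (unitg_inv_subproof u).

Lemma unitg_mulA : associative unitg_mul.
Proof. by move=> u v w; apply: val_inj; apply: mulrA. Qed.

Lemma unitg_mul1g : left_id unitg_one unitg_mul.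
Proof. by move=> u; apply: val_inj; apply: mul1r. Qed.

Lemma unitg_mulg1 : right_id unitg_one unitg_mul.
Proof. by move=> u; apply: val_inj; apply: mulr1. Qed.

Lemma unitg_mulVg : left_inverse unitg_one unitg_inv unitg_mul.
Proof. by move=> u; apply: val_inj; apply: mulVr; apply: unitgP. Qed.

Lemma unitg_mulgV : right_inverse unitg_one unitg_inv unitg_mul.
Proof. by move=> u; apply: val_inj; apply: divrr; apply: unitgP. Qed.

HB.instance Definition _ := isGroup.Build unitg
  unitg_mulA unitg_mul1g unitg_mulg1 unitg_mulVg unitg_mulgV.

End UnitGroup.

Notation GL2Z := (unitg 'M[int]_2).

Definition F2 := free_group 'I_2.
HB.instance Definition _ := Group.on F2.

Definition x : F2 := free_gen ord0.
Definition y : F2 := free_gen ord_max.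

(* The matrix, acting on row vectors, of the endomorphism of the abelianization
   of F2 induced by f. *)
Definition abel_mx (f : F2 -> F2) : 'M[int]_2 :=
  \matrix_(i, j) expsum j (f (free_gen i)).

Lemma expsum_morph (f : {multiplicative F2 -> F2}) j (w : F2) :
  expsum j (f w) = (\sum_k expsum k w * expsum j (f (free_gen k)))%R.
Proof.
pose P (g : F2) :=
  expsum j (f g) = (\sum_k expsum k g * expsum j (f (free_gen k)))%R.
have PM g h : P g -> P h -> P (g * h).
  rewrite /P gmulfM expsumM => -> ->; rewrite -big_split /=.
  by apply: eq_bigr => k _; rewrite expsumM mulrDl.
have PV g : P g -> P g^-1.
  rewrite /P morph_invg expsumV => ->; rewrite -sumrN.
  by apply: eq_bigr => k _; rewrite expsumV mulNr.
have Pgen t : P (free_gen t).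
  rewrite /P (bigD1 t) //= expsum_gen eqxx mul1r big1 ?addr0 // => k kt.
  by rewrite expsum_gen eq_sym (negPf kt) mul0r.
have P1 : P 1.
  rewrite /P morph_oneg expsum1 big1 // => k _; by rewrite expsum1 mul0r.
have wE : w = free_lift (@free_gen 'I_2) w by apply: (free_liftE (h := idfun)).
suff: P (free_lift (@free_gen 'I_2) w) by rewrite -wE.
rewrite /free_lift; elim: (word w) => //= a u IHu; apply: PM => //.
by rewrite /lift_letter; case: ifP => // _; apply: PV.
Qed.

Lemma abel_mxM (f g : autg F2) :
  abel_mx (f * g) = (abel_mx f * abel_mx g)%R.
Proof.
apply/matrixP => i j; rewrite !mxE (expsum_morph g).
by apply: eq_bigr => k _; rewrite !mxE.
Qed.

Lemma abel_mx1 : abel_mx (1 : autg F2) = 1%R.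
Proof. by apply/matrixP => i j; rewrite !mxE expsum_gen. Qed.

Lemma abel_mx_unit (f : autg F2) : abel_mx f \is a GRing.unit.
Proof.
by apply/unitrP; exists (abel_mx f^-1); rewrite -!abel_mxM mulVg mulgV abel_mx1.
Qed.

Definition abel_rep (f : autg F2) : GL2Z := Unitg (abel_mx_unit f).

Lemma abel_repM : {morph abel_rep : f g / f * g}.
Proof. by move=> f g; apply: val_inj; apply: abel_mxM. Qed.

HB.instance Definition _ :=
  isMultiplicative.Build (autg F2) GL2Z abel_rep abel_repM.

Definition palindromic_aut : {pred autg F2} :=
  [pred f : autg F2 | palindrome (f x) && palindrome (f y)].

Lemma ord2P (P : 'I_2 -> Prop) : P ord0 -> P ord_max -> forall i, P i.
Proof.
move=> P0 P1 [[|[|//]] ilt]; first by rewrite [Ordinal _](_ : _ = ord0) //; apply: val_inj.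
by rewrite [Ordinal _](_ : _ = ord_max) //; apply: val_inj.
Qed.

Lemma palindromic_autP (f : autg F2) :
  reflect (forall w, f (free_bar w) = free_bar (f w)) (f \in palindromic_aut).
Proof.
have barE t : free_bar (free_gen t) = (free_gen t)^-1 :> F2.
  by rewrite /free_bar free_lift_gen.
rewrite inE !palindromeE /x /y; apply: (iffP andP) => [[/eqP fx /eqP fy]|fC].
  apply: (@free_ext _ _ (f \o @free_bar _) (@free_bar _ \o f)) => t /=.
  by rewrite barE morph_invg; move: t; apply: ord2P.
by split; apply/eqP; rewrite -fC barE morph_invg.
Qed.

Lemma palindromic_aut_group_closed : group_closed palindromic_aut.
Proof.
split; first by apply/palindromic_autP.
move=> f g /palindromic_autP fC /palindromic_autP gC; apply/palindromic_autP => w.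
have gV (v : F2) : g (g^-1 v) = v.
  exact: (congr1 (fun h : autg F2 => h v) (mulVg g)).
apply: (bij_inj (autg_bij g)); change (g (g^-1 (f (free_bar w))) =
  g (free_bar (g^-1 (f w)))).
by rewrite gC !gV fC.
Qed.

Record PiA2 := PalindromicAut {
  PiA2_val :> autg F2;
  _ : PiA2_val \in palindromic_aut }.

HB.instance Definition _ := [isSub for PiA2_val].
HB.instance Definition _ := [Choice of PiA2 by <:].
HB.instance Definition _ :=
  SubChoice_isSubGroup.Build (autg F2) palindromic_aut PiA2
    palindromic_aut_group_closed.

Definition phi : {multiplicative PiA2 -> GL2Z} := abel_rep \o val.

Definition endo (p q : F2) : F2 -> F2 :=
  free_lift (fun i : 'I_2 => if i == ord0 then p else q).
HB.instance Definition _ p q := Multiplicative.on (endo p q).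

Lemma endo_x p q : endo p q x = p. Proof. exact: free_lift_gen. Qed.
Lemma endo_y p q : endo p q y = q. Proof. exact: free_lift_gen. Qed.

Lemma endo_cancel p q p' q' :
  endo p' q' p = x -> endo p' q' q = y -> cancel (endo p q) (endo p' q').
Proof.
move=> ex ey; apply: (@free_ext _ _ (endo p' q' \o endo p q) idfun).
by apply: ord2P; rewrite /= -/x -/y ?endo_x ?endo_y.
Qed.

Section PalindromicAutomorphism.
Variables p q p' q' : F2.
Hypothesis endoK : [/\ endo p' q' p = x, endo p' q' q = y,
  endo p q p' = x & endo p q q' = y].
Hypothesis pal : palindrome p && palindrome q.

Lemma endo_bij : bijective (endo p q).
Proof.
case: endoK => *; exists (endo p' q'); exact: endo_cancel.
Qed.

Lemma endo_palindromic : Autg (@gmulfM _ _ (endo p q)) endo_bij \in palindromic_aut.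
Proof. by rewrite inE /= endo_x endo_y. Qed.

Definition palindromic_endo : PiA2 := PalindromicAut endo_palindromic.

End PalindromicAutomorphism.

Ltac check_endo := by split; apply/eqP.

Fact mu12_endoK : [/\ endo (y^-1 * x * y^-1) y (y * x * y) = x,
  endo (y^-1 * x * y^-1) y y = y,
  endo (y * x * y) y (y^-1 * x * y^-1) = x & endo (y * x * y) y y = y].
Proof. check_endo. Qed.

Fact mu21_endoK : [/\ endo x (x^-1 * y * x^-1) x = x,
  endo x (x^-1 * y * x^-1) (x * y * x) = y,
  endo x (x * y * x) x = x & endo x (x * y * x) (x^-1 * y * x^-1) = y].
Proof. check_endo. Qed.

Fact sigma_endoK : [/\ endo x^-1 y x^-1 = x, endo x^-1 y y = y,
  endo x^-1 y x^-1 = x & endo x^-1 y y = y].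
Proof. check_endo. Qed.

Fact delta_endoK : [/\ endo x y^-1 x = x, endo x y^-1 y^-1 = y,
  endo x y^-1 x = x & endo x y^-1 y^-1 = y].
Proof. check_endo. Qed.

Fact rho_endoK : [/\ endo y x y = x, endo y x x = y,
  endo y x y = x & endo y x x = y].
Proof. check_endo. Qed.

Definition mu12 : PiA2 := palindromic_endo mu12_endoK isT.
Definition mu21 : PiA2 := palindromic_endo mu21_endoK isT.
Definition sigma : PiA2 := palindromic_endo sigma_endoK isT.
Definition delta : PiA2 := palindromic_endo delta_endoK isT.
Definition rho : PiA2 := palindromic_endo rho_endoK isT.

Lemma mu12E : mu12 x = y * x * y /\ mu12 y = y.
Proof. by split; rewrite /= (endo_x, endo_y). Qed.

Lemma mu21E : mu21 x = x /\ mu21 y = x * y * x.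
Proof. by split; rewrite /= (endo_x, endo_y). Qed.

Lemma sigmaE : sigma x = x^-1 /\ sigma y = y.
Proof. by split; rewrite /= (endo_x, endo_y). Qed.

Lemma deltaE : delta x = x /\ delta y = y^-1.
Proof. by split; rewrite /= (endo_x, endo_y). Qed.

Lemma rhoE : rho x = y /\ rho y = x.
Proof. by split; rewrite /= (endo_x, endo_y). Qed.

(* The matrix with rows (a, b) and (c, d). *)
Definition mx22 (a b c d : int) : 'M[int]_2 :=
  \matrix_(i, j) if i == ord0 then if j == ord0 then a else b
                 else if j == ord0 then c else d.

(* Main.v *)
Require Import Defs.
From mathcomp Require Import all_boot all_algebra.
From mathcomp Require Import zify.

(** Let f be a palindromic automorphism, with p and q the images of x and y.
    Faithfulness says that the exponent sums of p and q determine f. The link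
    between lengths and exponent sums is a Euclidean algorithm on the pair
    (p, q), whose steps replace p by q^-1 p q^-1 or by q p q; on the matrix of f
    they subtract twice the row of q from the row of p, or add it.

    Lengths are handled through the geometry of the Cayley tree: gprod g h, the
    length of the common prefix of g and h, is the Gromov product, so it is
    determined by lengths (flen_divl) and is ultrametric
    (gprod_ultrametric); most cancellation arguments then become linear
    arithmetic. There are three steps.

    First, p and q have odd length, since a palindrome of even length has even
    exponent sums (PiA2_odd). If |q| <= |p| and no Euclidean step shortens p,
    then less than half of each of p, q and their inverses cancels in any
    product of two of them, so that the middle letters survive and the length of
    f w is bounded below in terms of that of w (free_lift_flen). As x and y are
    values of f, this forces |p| = |q| = 1 (PiA2_irreducible).

    Secondly, if |q| < |p| then p is obtained from q and some p' with
    |p'| <= |q| by k > 0 equal steps (PiA2_euclid), so that the row of p is the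
    row of p' plus or minus 2k times the row of q. By induction on lengths the
    row of p' is shorter than that of q, unless p' and q are letters; in both
    cases the row of p is longer than that of q (enorm_lt).

    Lastly, if the matrix of f is the identity, then its rows are equally long,
    so |p| = |q| by the second step, hence |p| = |q| = 1; a letter is determined
    by its exponent sums, so f is the identity (PiA2_one). *)

Set Implicit Arguments.
Unset Strict Implicit.
Unset Printing Implicit Defensive.

Import GRing.Theory.

(** * Common prefixes of sequences *)

Fixpoint lcp (E : eqType) (u v : seq E) : nat :=
  match u, v with
  | a :: u', b :: v' => if a == b then (lcp u' v').+1 else 0
  | _, _ => 0
  end.

Section CommonPrefix.
Variable E : eqType.
Implicit Types u v w : seq E.

Lemma lcpC u v : lcp u v = lcp v u.
Proof.
by elim: u v => [|a u IHu] [|b v] //=; rewrite eq_sym IHu.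
Qed.

Lemma lcp_ultrametric u v w : minn (lcp u v) (lcp v w) <= lcp u w.
Proof.
elim: u v w => [|a u IHu] [|b v] [|c w] //=; rewrite ?minn0 ?min0n //.
case: (eqVneq a b) => [->|_]; last by rewrite min0n.
by case: (eqVneq b c) => _; rewrite ?minn0 // minnSS ltnS.
Qed.

Lemma take_lcp u v n : n <= lcp u v -> take n u = take n v.
Proof.
elim: u v n => [|a u IHu] [|b v] [|n] //=.
by case: eqP => //= -> /IHu ->.
Qed.

(** A common prefix of at least half the length of two palindromes is also, by
    reversal, a common suffix, and the two cover both words. *)
Lemma palindrome_eq_half u v : rev u = u -> rev v = v -> size u = size v ->
  size u <= (lcp u v).*2 -> u = v.
Proof.
move=> ru rv suv half; have [k kE] : exists k, k = lcp u v by exists (lcp u v).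
rewrite -(cat_take_drop k u) -(cat_take_drop k v).
have pre := @take_lcp u v; congr (_ ++ _); first by apply: pre; rewrite kE.
rewrite -ru -rv !drop_rev suv; congr rev; apply: pre; lia.
Qed.

End CommonPrefix.

(** * Length and Gromov product in a free group *)

Section Length.
Variable T : choiceType.
Local Open Scope group_scope.
Implicit Types (a b : T * bool) (g h k p q : free_group T).

Definition flen g : nat := size (word g).
Definition gprod g h : nat := lcp (word g) (word h).

(** Free reduction of u^-1 v deletes exactly the common prefix, once on each
    side. *)
Lemma size_cat_reduce_inv (u v : seq (T * bool)) : reduced u -> reduced v ->
  size (cat_reduce (inv_word u) v) + (lcp u v).*2 = (size u + size v)%N.
Proof.
elim: u v => [|a u IHu] v uP vP; first by rewrite /= addn0.
rewrite /inv_word /= rev_cons -cats1 /cat_reduce foldr_cat -/(inv_word u) /=.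
rewrite -/(cat_reduce _ _); have u'P := reduced_cons uP.
case: v vP => [_|b v vP] /=;
  last (rewrite inv_letterK; case: (eqVneq a b) => [ab|ab]).
- have := IHu [:: inv_letter a] u'P isT.
  have -> : lcp u [:: inv_letter a] = 0%N.
    by case: {IHu u'P} u uP => //= c u /andP[/negPf ->].
  by rewrite /=; lia.
- have := IHu v u'P (reduced_cons vP); lia.
(* The inverted first letter of u moves to v, and then nothing cancels. *)
- have := IHu (inv_letter a :: b :: v) u'P; rewrite /= inv_letterK eq_sym ab.
  move: (vP : reduced (b :: v)); rewrite /reduced /= => ->.
  have -> : lcp u (inv_letter a :: b :: v) = 0%N.
    by case: {IHu u'P} u uP => //= c u /andP[/negPf ->].
  by move=> /(_ isT); rewrite /=; lia.
Qed.

Lemma flen_divl g h : flen (g^-1 * h) + (gprod g h).*2 = flen g + flen h.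
Proof. exact: size_cat_reduce_inv (wordP g) (wordP h). Qed.

Lemma flenV g : flen g^-1 = flen g.
Proof. by rewrite /flen /= /inv_word size_rev size_map. Qed.

Lemma flen_bar g : flen (free_bar g) = flen g.
Proof. by rewrite /flen word_bar size_map. Qed.

Lemma gprodC g h : gprod g h = gprod h g.
Proof. exact: lcpC. Qed.

Lemma gprodgg g : gprod g g = flen g.
Proof. by have := flen_divl g g; rewrite mulVg {1}/flen /=; lia. Qed.

Lemma gprod_ultrametric g h k : minn (gprod g h) (gprod h k) <= gprod g k.
Proof. exact: lcp_ultrametric. Qed.

Lemma free_barM g h : free_bar (g * h) = free_bar g * free_bar h.
Proof. exact: free_liftM. Qed.

Lemma free_barV g : free_bar g^-1 = (free_bar g)^-1.
Proof. exact: (morph_invg (@free_bar T)). Qed.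

Lemma palindromeV p : palindrome p -> palindrome p^-1.
Proof. by rewrite !palindromeE free_barV => /eqP->. Qed.

(** Reversal preserves lengths and exchanges p q and q p. *)
Lemma flen_palindromeM p q : palindrome p -> palindrome q ->
  flen (p * q) = flen (q * p).
Proof.
rewrite !palindromeE => /eqP pV /eqP qV.
by rewrite -flen_bar free_barM pV qV -invgM flenV.
Qed.

Lemma gprod_palindromeV p q : palindrome p -> palindrome q ->
  gprod p^-1 q^-1 = gprod p q.
Proof.
move=> pP qP; have := flen_divl p q; have := flen_divl p^-1 q^-1.
rewrite invgK !flenV (flen_palindromeM pP (palindromeV qP)) -flenV invgM invgK.
by move=> <- /addnI/double_inj ->.
Qed.

(** A palindrome has the same first and last letter, so it is cyclically
    reduced. *)
Lemma gprod_palindrome_inv p : palindrome p -> gprod p p^-1 = 0%N.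
Proof.
move/eqP; rewrite /gprod /= /inv_word -map_rev => ->.
by case: (word p) => //= -[t s] w; case: eqP => // -[]; case: s.
Qed.

(** * Cancellation between palindromes *)

(** The four point condition of the tree for 1, p^-1, q^-1 and p^-1 q. The
    products i = (p^-1 | p^-1 q), j = (q^-1 | p^-1 q) and
    (p^-1 | q^-1) = (p | q) satisfy the ultrametric inequalities, and j measures
    q^-1 p q^-1. *)
Lemma palindrome_four_points p q : palindrome p -> palindrome q ->
  exists i j : nat,
  [/\ i + gprod p q = flen p,
      j.*2 + flen (q^-1 * p * q^-1) + (gprod p q).*2 = flen p + (flen q).*2,
      minn i j <= gprod p q, minn i (gprod p q) <= j & minn (gprod p q) j <= i].
Proof.
move=> pP qP; have e1 := flen_divl p q; have eV := gprod_palindromeV pP qP.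
exists (gprod p^-1 (p^-1 * q)), (gprod q^-1 (p^-1 * q)).
have e2 := flen_divl p^-1 (p^-1 * q); rewrite mulKg flenV in e2.
have e3 := flen_divl q^-1 (p^-1 * q).
have D' : flen (q^-1^-1 * (p^-1 * q)) = flen (q^-1 * p * q^-1).
  by rewrite -flenV !invgM !invgK.
rewrite D' flenV in e3.
have u := gprod_ultrametric p^-1 (p^-1 * q) q^-1.
have u' := gprod_ultrametric q^-1 p^-1 (p^-1 * q).
have u'' := gprod_ultrametric p^-1 q^-1 (p^-1 * q).
rewrite (gprodC q^-1 p^-1) in u'; rewrite (gprodC (p^-1 * q)) in u.
by rewrite eV in u u' u''; split; lia.
Qed.

(** If q^-1 p q^-1 is not shorter than p, then the four point condition leaves
    only |p| = |q|, and then p = q as they agree on more than half of their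
    length. *)
Lemma palindrome_reduction p q : palindrome p -> palindrome q ->
  flen q <= flen p -> flen q < (gprod p q).*2 -> p != q ->
  flen (q^-1 * p * q^-1) < flen p.
Proof.
move=> pP qP qp c_gt; apply: contraNltn => D_ge.
have [i [j [e1 e2 u1 u2 u3]]] := palindrome_four_points pP qP.
apply/eqP/val_inj/palindrome_eq_half; try exact/eqP.
- by change (flen p = flen q); lia.
- change (flen p <= (gprod p q).*2); lia.
Qed.

(** For equal lengths the four point condition would turn a shortening into a
    cancellation of exactly half of p, whose length is odd. *)
Lemma palindrome_no_reduction p q : palindrome p -> palindrome q ->
  odd (flen p) -> flen q = flen p -> flen p <= flen (q^-1 * p * q^-1).
Proof.
move=> pP qP pO qp.
have [i [j [e1 e2 u1 u2 u3]]] := palindrome_four_points pP qP; lia.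
Qed.

Lemma palindrome_short p q : palindrome p -> palindrome q ->
  odd (flen q) -> flen q <= flen p -> p != q ->
  flen p <= flen (q^-1 * p * q^-1) -> (gprod p q).*2 < flen q.
Proof.
move=> pP qP qO le_qp pq; rewrite ltnNge; apply: contraTN => gt.
(* Exactly half of q cannot cancel, because its length is odd. *)
by rewrite -ltnNge; apply: palindrome_reduction => //; lia.
Qed.

Lemma palindrome_expsum_even t p :
  palindrome p -> ~~ odd (flen p) -> exists k : int, expsum t p = (k *+ 2)%R.
Proof.
rewrite /palindrome /expsum /flen => /eqP; move: (word p) => w rw ow.
have {ow rw} -> : w = take (size w)./2 w ++ rev (take (size w)./2 w).
  rewrite -[LHS](cat_take_drop (size w)./2); congr (_ ++ _).
  have <- : drop (size w)./2 (rev w) = rev (take (size w)./2 w).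
    by rewrite drop_rev; congr (rev (take _ w)); lia.
  by rewrite rw.
exists (\sum_(a <- take (size w)./2 w | a.1 == t) (-1) ^+ a.2)%R.
rewrite big_cat /= mulr2n; congr (_ + _)%R.
by apply: perm_big; rewrite perm_rev.
Qed.

Lemma flen1P g :
  flen g = 1%N -> exists a, g = lift_letter (@free_gen T) a.
Proof.
case: g => -[|a [|b w]] // wP _; exists a; apply: val_inj => /=.
by case: a {wP} => t [].
Qed.

End Length.

(** * Survival of middle letters *)

Section PingPong.
Variables (S T : choiceType) (f : S -> free_group T).
Local Open Scope group_scope.

(** When the images of letters cancel less than half of each other, the first
    half of the image of the first letter, including its middle, survives in the
    image of a reduced word. That survival, stated by the Gromov product, is
    proved together with the bound; the bound counts half of the first image and
    at least one letter for each further letter of the word. *)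
Lemma free_lift_flen :
  (forall a b, a != b ->
     (gprod (lift_letter f a) (lift_letter f b)).*2 < flen (lift_letter f a)) ->
  forall g a w, word g = a :: w ->
  flen (lift_letter f a) + (size w).*2 < (flen (free_lift f g)).*2.
Proof.
move=> short [u uP] a w /= uE; rewrite /free_lift /= {u}uE in uP *.
suff [_ //] : flen (lift_letter f a) <
    (gprod (foldr (fun b h => lift_letter f b * h) 1 (a :: w))
           (lift_letter f a)).*2
  /\ flen (lift_letter f a) + (size w).*2 <
    (flen (foldr (fun b h => lift_letter f b * h) 1 (a :: w))).*2.
elim: w a uP => [|b w IHw] a awP.
  have /short : a != inv_letter a.
    by case: a {awP} => t []; rewrite -pair_eqE /= andbF.
  rewrite /= mulg1 gprodgg; lia.
have ba : inv_letter a != b by case/andP: awP; rewrite eq_sym.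
have [] := IHw b (reduced_cons awP).
set h := foldr _ _ _ => hb hlen; set s := lift_letter f a.
rewrite -[foldr _ _ _]/(s * h) [size _]/=.
have sV : lift_letter f (inv_letter a) = s^-1 by exact: lift_letterV.
have short1 := short _ _ ba; rewrite sV flenV in short1.
have short2 : (gprod s^-1 (lift_letter f b)).*2 < flen (lift_letter f b).
  by rewrite -sV gprodC short // eq_sym.
(* The image h of the tail agrees with the image of b beyond its middle, but
   s^-1 does not, so s cancels no more against h than against the image of b. *)
have u := gprod_ultrametric s^-1 h (lift_letter f b).
have e1 : flen (s * h) + (gprod s^-1 h).*2 = flen s + flen h.
  by have := flen_divl s^-1 h; rewrite invgK flenV.
have e2 := flen_divl s (s * h); rewrite mulKg in e2.
by rewrite (gprodC (s * h)); split; lia.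
Qed.

End PingPong.

Section BasisPair.
Local Open Scope group_scope.

(** For a pair that no Euclidean step shortens, any two letter images cancel
    less than half of either: nothing cancels between a palindrome and itself,
    and reversal reduces the other pairs to (p, q) and (p, q^-1). *)
Lemma palindrome_basis_short (T : choiceType) (f : 'I_2 -> free_group T) :
  let p := f ord0 in let q := f ord_max in
  palindrome p -> palindrome q -> odd (flen q) -> flen q <= flen p ->
  p != q -> p != q^-1 ->
  flen p <= flen (q^-1 * p * q^-1) -> flen p <= flen (q * p * q) ->
  forall a b, a != b ->
  (gprod (lift_letter f a) (lift_letter f b)).*2 < flen (lift_letter f a).
Proof.
move=> p q pP qP qO le_qp pq pqV red1 red2.
have g1 := palindrome_short pP qP qO le_qp pq red1.
have g2 : (gprod p q^-1).*2 < flen q.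
  have := palindrome_short pP (palindromeV qP); rewrite flenV invgK; exact.
have E1 := gprod_palindromeV pP qP.
have E2 : gprod p^-1 q = gprod p q^-1.
  by rewrite -(gprod_palindromeV pP (palindromeV qP)) invgK.
have Z1 := gprod_palindrome_inv pP; have Z2 := gprod_palindrome_inv qP.
have q0 : 0 < flen q by lia.
have p0 : 0 < flen p by lia.
have short (s s' : bool) :
    (gprod (lift_letter f (ord0, s)) (lift_letter f (ord_max, s'))).*2 < flen q.
  rewrite /lift_letter /= -/p -/q.
  by case: s s' => -[]; rewrite ?E1 ?E2 ?g1 ?g2.
have flen_letter t s : flen (lift_letter f (t, s)) = flen (f t).
  by rewrite /lift_letter /=; case: s; rewrite ?flenV.
have opp t s s' : gprod (f t) (f t)^-1 = 0%N -> s != s' ->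
    gprod (lift_letter f (t, s)) (lift_letter f (t, s')) = 0%N.
  by move=> Z; rewrite /lift_letter; case: s s' => -[] //= _; rewrite // gprodC.
case=> t s [t' s']; move: t t'; apply: ord2P; apply: ord2P => ab;
  rewrite flen_letter.
- by rewrite opp //; apply: contraNneq ab => ->.
- exact: leq_trans (short _ _) le_qp.
- by rewrite gprodC.
- by rewrite opp //; apply: contraNneq ab => ->.
Qed.

End BasisPair.

(** * Palindromic automorphisms *)

Section PalindromicAutomorphisms.
Local Open Scope group_scope.
Implicit Types (f : PiA2) (t : 'I_2) (w p q : F2).

Lemma PiA2M f w w' : f (w * w') = f w * f w'.
Proof. exact: autgM. Qed.

Lemma PiA2V f w : f w^-1 = (f w)^-1.
Proof. exact: (morph_invg (PiA2_val f)). Qed.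

Lemma PiA2_surj f w : exists w', f w' = w.
Proof.
exists ((PiA2_val f)^-1 w).
exact: (congr1 (fun h : autg F2 => h w) (mulVg (PiA2_val f))).
Qed.

Lemma PiA2_inj f : injective f.
Proof. exact/bij_inj/autg_bij. Qed.

Lemma PiA2_palindrome f t : palindrome (f (free_gen t)).
Proof. by case: f t => f /= /andP[? ?]; apply: ord2P. Qed.

(** If f t had even length, its exponent sums would be even, and so would be
    those of t, its image under the inverse of f. *)
Lemma PiA2_odd f t : odd (flen (f (free_gen t))).
Proof.
apply: contraT => even.
have even_f s := palindrome_expsum_even s (PiA2_palindrome f t) even.
pose g := (PiA2_val f)^-1; have gK : g (f (free_gen t)) = free_gen t.
  exact: (congr1 (fun h : autg F2 => h (free_gen t)) (mulgV (PiA2_val f))).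
have : expsum t (g (f (free_gen t))) =
    (\sum_k expsum k (f (free_gen t)) * expsum t (g (free_gen k)))%R.
  exact: expsum_morph.
rewrite gK expsum_gen eqxx big_ord_recl big_ord1.
have [k ->] := even_f ord0; have [l ->] := even_f (lift ord0 ord0).
move: (expsum t _) (expsum t _) => c d; lia.
Qed.

Lemma PiA2_basis_neq f : (f x != f y) && (f x != (f y)^-1).
Proof. by rewrite -PiA2V !(inj_eq (@PiA2_inj f)). Qed.

(** By the bound on lengths, only letters can be mapped to letters. *)
Lemma letter_preimage f w : flen w = 1%N ->
  (forall a b, a != b ->
     (gprod (lift_letter (f \o @free_gen _) a)
            (lift_letter (f \o @free_gen _) b)).*2
        < flen (lift_letter (f \o @free_gen _) a)) ->
  exists a : 'I_2 * bool, w = f (lift_letter (@free_gen _) a)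
    /\ flen (f (free_gen a.1)) = 1%N.
Proof.
move=> w1 short; have [g gw] := PiA2_surj f w; rewrite -gw in w1 *.
have fE : f g = free_lift (f \o @free_gen _) g.
  exact: (@free_liftE _ _ _ (PiA2_val f) (fun=> erefl)).
have bound a u : word g = a :: u ->
    flen (lift_letter (f \o @free_gen _) a) + (size u).*2 < (flen (f g)).*2.
  by rewrite fE; apply: free_lift_flen.
have g1 : flen g = 1%N.
  case gE : (word g) => [|a u]; last first.
    have := bound _ _ gE; rewrite w1 /flen gE /=.
    by case: (size u) => // n; lia.
  have : g = 1 by apply: val_inj.
  by move=> g1; move: w1; rewrite g1 (morph_oneg (PiA2_val f)).
have [a ga] := flen1P g1; exists a; split; first by rewrite ga.
have gE : word g = [:: a].
  by rewrite ga /lift_letter; case: a {ga} => t [].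
have := bound _ _ gE; rewrite w1 addn0.
have -> : flen (lift_letter (f \o @free_gen _) a) = flen (f (free_gen a.1)).
  by rewrite /lift_letter; case: ifP => // _; rewrite flenV.
by case: (flen _) (PiA2_odd f a.1) => [|[|n]].
Qed.

(** Both x and y are values of f, hence images of letters; these letters cannot
    both be y or its inverse, so the image of x has length 1. *)
Lemma PiA2_irreducible f : flen (f y) <= flen (f x) ->
  flen (f x) <= flen ((f y)^-1 * f x * (f y)^-1) ->
  flen (f x) <= flen (f y * f x * f y) ->
  flen (f x) = 1%N.
Proof.
move=> le_yx red1 red2; have [pq pqV] := andP (PiA2_basis_neq f).
have short := @palindrome_basis_short _ (f \o @free_gen _)
  (PiA2_palindrome f ord0) (PiA2_palindrome f ord_max) (PiA2_odd f ord_max)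
  le_yx pq pqV red1 red2.
have [[a s] [xE fa1]] := @letter_preimage f x erefl short.
have [[b s'] [yE fb1]] := @letter_preimage f y erefl short.
move: a b xE fa1 yE fb1; apply: ord2P; apply: ord2P => //= xE _ yE _.
pose g s : F2 := lift_letter (@free_gen 'I_2) (ord_max, s).
have : (f (g s') == f (g s)) || (f (g s') == f (g s)^-1).
  rewrite /g /lift_letter; case: s s' {xE yE} => -[];
    by rewrite /= ?invgK eqxx ?orbT.
by rewrite PiA2V -xE -yE.
Qed.

(** * The Euclidean algorithm *)

(** One Euclidean step; as in letters, s = true stands for the inverse of q. *)
Definition twist (s : bool) q p : F2 :=
  (if s then q^-1 else q) * p * (if s then q^-1 else q).

Lemma twistK s q : cancel (twist s q) (twist (~~ s) q).
Proof.
case: s => p; rewrite /twist /= !mulgA.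
  by rewrite mulgV mul1g mulgVK.
by rewrite mulVg mul1g mulgK.
Qed.

Lemma expsum_twist s q p t :
  expsum t (twist s q p) = (expsum t p + ((-1) ^+ s * expsum t q) *+ 2)%R.
Proof.
by rewrite /twist !expsumM; case: s; rewrite ?expsumV /= ?expr1 ?expr0; lia.
Qed.

(** The steps are realised by mu12 and by its conjugate by delta. *)
Lemma PiA2_twist f s :
  exists2 f' : PiA2, f' y = f y & f' x = twist s (f y) (f x).
Proof.
have mu12y g : (mu12 * g : PiA2) y = g y.
  by rewrite -[LHS]/(g (mu12 y)) (proj2 mu12E).
have mu12x g : (mu12 * g : PiA2) x = g y * g x * g y.
  by rewrite -[LHS]/(g (mu12 x)) (proj1 mu12E) !PiA2M.
have deltay g : (delta * g : PiA2) y = (g y)^-1.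
  by rewrite -[LHS]/(g (delta y)) (proj2 deltaE) PiA2V.
have deltax g : (delta * g : PiA2) x = g x.
  by rewrite -[LHS]/(g (delta x)) (proj1 deltaE).
case: s; last by exists (mu12 * f); [rewrite mu12y | rewrite mu12x].
exists (delta * (mu12 * (delta * f))).
  by rewrite deltay mu12y deltay invgK.
by rewrite deltax mu12x deltay deltax.
Qed.

Lemma PiA2_y_gt0 f : 0 < flen (f y).
Proof. exact: odd_gt0 (PiA2_odd f ord_max). Qed.

Lemma PiA2_twist_reduces f : flen (f y) <= flen (f x) -> 1 < flen (f x) ->
  exists s, flen (twist s (f y) (f x)) < flen (f x).
Proof.
move=> le_yx x_gt1.
case: (ltnP (flen (twist true (f y) (f x))) (flen (f x))) => [|red1].
  by exists true.
case: (ltnP (flen (twist false (f y) (f x))) (flen (f x))) => [|red2].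
  by exists false.
by have := PiA2_irreducible le_yx red1 red2; lia.
Qed.

Lemma PiA2_flen_eq f : flen (f x) = flen (f y) -> flen (f x) = 1%N.
Proof.
have [xP yP] := (PiA2_palindrome f ord0, PiA2_palindrome f ord_max).
move=> eq_xy; have xO := PiA2_odd f ord0.
apply: PiA2_irreducible; first by rewrite eq_xy.
  by apply: palindrome_no_reduction.
have := @palindrome_no_reduction _ (f x) (f y)^-1; rewrite invgK; apply=> //.
  exact: palindromeV.
by rewrite flenV.
Qed.

Lemma PiA2_swap f : (rho * f : PiA2) x = f y /\ (rho * f : PiA2) y = f x.
Proof.
rewrite -[(rho * f : PiA2) x]/(f (rho x)) -[(rho * f : PiA2) y]/(f (rho y)).
by have [-> ->] := rhoE.
Qed.

(** A step of the opposite sign would undo the previous one, so all steps until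
    f' x is no longer than f y have the same sign s. *)
Lemma PiA2_euclid f s : flen (f y) < flen (f x) ->
  flen (twist s (f y) (f x)) < flen (f x) ->
  exists2 f' : PiA2, f' y = f y /\ flen (f' x) <= flen (f y)
    & exists2 k, 0 < k & forall t, expsum t (f' x) =
        (expsum t (f x) + ((-1) ^+ s * expsum t (f y)) *+ k.*2)%R.
Proof.
have [n] := ubnP (flen (f x)); elim: n f => // n IHn f le_n lt_yx red.
have [f' f'y f'x] := PiA2_twist f s.
case: (leqP (flen (f' x)) (flen (f y))) => [le|gt].
  by exists f' => //; exists 1%N => // t; rewrite f'x expsum_twist.
have [s' red'] : exists s', flen (twist s' (f' y) (f' x)) < flen (f' x).
  have fy_gt0 := PiA2_y_gt0 f.
  by apply: PiA2_twist_reduces; rewrite ?f'y; lia.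
have {s' red'} red' : flen (twist s (f' y) (f' x)) < flen (f' x).
  have [<- //|ss'] := eqVneq s' s.
  have s'E : s' = ~~ s by move: ss'; clear; case: s s' => -[].
  by move: red'; rewrite s'E f'y f'x twistK; lia.
have [||f'' [f''y f''x] [k k_gt0 kE]] := IHn f' _ _ red'.
- by rewrite f'x; lia.
- by rewrite f'y.
exists f''; first by rewrite -f'y.
exists k.+1 => // t; rewrite kE f'y f'x expsum_twist -addrA -mulrnDr.
by congr (_ + _ *+ _)%R; lia.
Qed.

(** * Comparison with the matrix *)

Definition enorm w : nat := `|expsum ord0 w| + `|expsum ord_max w|.

Lemma expsum_letter t (a : 'I_2 * bool) :
  expsum t (lift_letter (@free_gen _) a) =
  (if a.1 == t then (-1) ^+ a.2 else 0)%R.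
Proof.
case: a => r s; rewrite /lift_letter /=.
by case: s; rewrite ?expsumV expsum_gen; case: eqP; rewrite ?oppr0.
Qed.

Lemma enorm_letter w : flen w = 1%N -> enorm w = 1%N.
Proof.
case/flen1P => a ->; rewrite /enorm !expsum_letter.
by case: a => a s; move: a; apply: ord2P; case: s.
Qed.

Lemma absz_euclid (a b c : int) s k : 0 < k ->
  b = (a + ((-1) ^+ s * c) *+ k.*2)%R -> (`|c|.*2 <= `|a| + `|b|)%N.
Proof.
move=> k_gt0 bE; have [m mE m_ge] : exists2 m, m = ((-1) ^+ s * c *+ k.*2)%R
    & (`|c|.*2 <= `|m|)%N.
  eexists; first by [].
  by rewrite -mulr_natr abszM abszMsign natz absz_nat -muln2 leq_mul //; lia.
rewrite -mE in bE; lia.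
Qed.

Lemma PiA2_letters_neq f a b :
  f x = lift_letter (@free_gen _) a -> f y = lift_letter (@free_gen _) b ->
  a.1 != b.1.
Proof.
move=> fx fy; have := PiA2_basis_neq f; rewrite fx fy.
case: a b {fx fy} => a s [b s'] /=; apply: contraTneq => ->.
rewrite /lift_letter /=; case: s s' => -[]; rewrite ?invgK eqxx ?andbF //.
Qed.

(** By the triangle inequality 2 |row of q| <= |row of p| + |row of p'|; when p'
    is shorter than q, induction applies to the pair (q, p'), and when p' and q
    have the same length they are letters of distinct generators. *)
Lemma enorm_lt f : flen (f y) < flen (f x) -> enorm (f y) < enorm (f x).
Proof.
have [n] := ubnP (flen (f x) + flen (f y)).
elim: n f => // n IHn f le_n lt_yx; have fy_gt0 := PiA2_y_gt0 f.
have [s red] : exists s, flen (twist s (f y) (f x)) < flen (f x).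
  by apply: PiA2_twist_reduces; lia.
have [f' [f'y le_f'x] [k k_gt0 kE]] := PiA2_euclid lt_yx red.
have tri t := absz_euclid k_gt0 (kE t).
have tri0 := tri ord0; have tri1 := tri ord_max.
have [rx ry] := PiA2_swap f'.
case: (ltngtP (flen (f' x)) (flen (f y))) le_f'x => // [lt|eq] _.
  have := IHn (rho * f'); rewrite rx ry f'y => /(_ _ lt).
  rewrite /enorm => H; have {}H := H ltac:(lia); lia.
have f'x1 : flen (f' x) = 1%N by apply: PiA2_flen_eq; rewrite f'y.
have fy1 : flen (f y) = 1%N by rewrite -eq.
have f'y1 : flen (f' y) = 1%N by rewrite f'y.
have [a aE] := flen1P f'x1; have [b bE] := flen1P f'y1.
have ab := PiA2_letters_neq aE bE.
have e0 : expsum b.1 (f' x) = 0%R by rewrite aE expsum_letter (negPf ab).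
have e1 : `|expsum b.1 (f y)|%N = 1%N.
  by rewrite -f'y bE expsum_letter eqxx; case: (b.2).
(* At the letter of q, the exponent sum of p' vanishes, so that of p is at
   least 2 in absolute value. *)
have := tri b.1; rewrite e0 e1 (enorm_letter fy1) /enorm addn0.
by move: (b.1); apply: ord2P; lia.
Qed.

(** The rows have the same norm, so by enorm_lt and its mirror image under
    rho the images of x and y have the same length; so both are letters. *)
Lemma PiA2_one f :
  (forall t r, expsum t (f (free_gen r)) = (r == t)%:R%R) -> f = 1.
Proof.
move=> fE.
have flen_eq : flen (f x) = flen (f y).
  have n1 : enorm (f x) = enorm (f y) by rewrite /enorm !fE.
  have [rx ry] := PiA2_swap f.
  have lt1 := @enorm_lt f; have lt2 := @enorm_lt (rho * f).
  rewrite n1 ltnn in lt1; rewrite rx ry n1 ltnn in lt2.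
  by case: (ltngtP (flen (f x)) (flen (f y))) => // [/lt2|/lt1].
have fx1 := PiA2_flen_eq flen_eq.
have flen1 r : flen (f (free_gen r)) = 1%N.
  by move: r; apply: ord2P; [exact: fx1 | exact: etrans (esym flen_eq) fx1].
have f_gen r : f (free_gen r) = free_gen r.
  have [a aE] := flen1P (flen1 r); have := fE r r.
  rewrite aE expsum_letter eqxx; case: a {aE} => t s.
  by case: eqP => //= -> ; case: s.
apply: val_inj; apply: autg_ext.
exact: (@free_ext _ _ (PiA2_val f) idfun f_gen).
Qed.

Lemma phi_mx22 f : unitg_val (phi f) =
  mx22 (expsum ord0 (f x)) (expsum ord_max (f x))
       (expsum ord0 (f y)) (expsum ord_max (f y)).
Proof. by apply/matrixP; apply: ord2P; apply: ord2P; rewrite !mxE. Qed.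

Lemma phi_inj : injective phi.
Proof.
move=> f g fg; apply/eqP; rewrite -divg_eq1; apply/eqP/PiA2_one => t r.
have : unitg_val (phi (f / g)) = 1%:M%R.
  by rewrite gmulfM morph_invg fg mulgV.
by move/matrixP/(_ r t); rewrite !mxE.
Qed.

End PalindromicAutomorphisms.

Local Open Scope ring_scope.

Theorem proposition4p1 :
  [/\ unitg_val (phi mu12) = mx22 1 2 0 1,
      unitg_val (phi mu21) = mx22 1 0 2 1,
      unitg_val (phi sigma) = mx22 (-1) 0 0 1,
      unitg_val (phi delta) = mx22 1 0 0 (-1) &
      unitg_val (phi rho) = mx22 0 1 1 0]
  /\ injective phi.
Proof.
split; last exact: phi_inj.
by split; rewrite phi_mx22
    ?(proj1 mu12E, proj2 mu12E, proj1 mu21E, proj2 mu21E, proj1 sigmaE,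
      proj2 sigmaE, proj1 deltaE, proj2 deltaE, proj1 rhoE, proj2 rhoE);
  rewrite ?expsumM ?expsumV !expsum_gen.
Qed.
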